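(* Let $(R,M)$ be a finite commutative local ring with identity such that the graph $\Gamma_{\mathrm{Aut}\,R}(R)$ is totally disconnected. Then $R$ is isomorphic to $\mathbb{Z}_{p^{\alpha}}$ for some prime $p$ and some integer $\alpha\ge 1$, or to $\mathbb{Z}_2[X]/(X^2)$.
   Context: All rings are commutative with identity; $\mathbb{Z}_n$ is the ring of integers modulo $n$; $(R,M)$ denotes a local ring with maximal ideal $M$. $\mathrm{Aut}\,R$ is the group of ring automorphisms of $R$. The graph $\Gamma_{\mathrm{Aut}\,R}(R)$ is the simple graph whose vertices are the elements of $R$, where two distinct vertices $x,y$ are adjacent if and only if there is $\sigma\in\mathrm{Aut}\,R$ with $\sigma(x)=y$. A graph is totally disconnected if it has no edges. *)

(* Defs.v *)
From mathcomp Require Import all_boot all_algebra.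

Set Implicit Arguments.
Unset Strict Implicit.
Unset Printing Implicit Defensive.

Import GRing.Theory.
Local Open Scope ring_scope.

(* [idealr_closed] includes 1 \notin I, so it describes the proper ideals, and
   a maximal ideal is a maximal element among these. *)
Definition maximal_ideal (R : finComNzRingType) (M : {set R}) : Prop :=
  idealr_closed M /\
  (forall I : {set R}, idealr_closed I -> M \subset I -> I = M).

Definition local_ring (R : finComNzRingType) (M : {set R}) : Prop :=
  maximal_ideal M /\ (forall N : {set R}, maximal_ideal N -> N = M).

Definition ring_isomorphic (A B : nzRingType) : Prop :=
  exists f : {rmorphism A -> B}, bijective f.

(* Since automorphisms form a group, this relation is symmetric. *)
Definition aut_adj (R : nzRingType) (x y : R) : Prop :=
  x <> y /\ exists s : {rmorphism R -> R}, bijective s /\ s x = y.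

Definition totally_disconnected (V : Type) (adj : V -> V -> Prop) : Prop :=
  forall x y : V, ~ adj x y.

(* [{poly %/ p}] is the quotient by p only if p is monic of positive degree
   (see [mk_monic]); this lemma checks it for p = 'X^2. *)
Lemma mk_monic_X2 : mk_monic ('X^2 : {poly 'Z_2}) = 'X^2.
Proof. by rewrite /mk_monic size_polyXn monicXn. Qed.

(* Main.v *)
From HB Require Import structures.
Require Import Defs.
From mathcomp Require Import all_boot all_algebra all_field ring.
Import GRing.Theory.
Local Open Scope ring_scope.
Set Implicit Arguments.
Unset Strict Implicit.

(** Let p be the residue characteristic and q = p^d with x^q = x mod M for all
    x in R.

    If M <> pR, take an ideal I maximal among those with pR <= I < M. Then
    M M <= I and M = I + R x for some x. For y in M annihilated by M, the map
    phi : i + r x |-> r y is well defined and a |-> phi (a - a^q) is a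
    derivation, because a |-> a^q is multiplicative, and additive modulo pR.
    So a |-> a + phi (a - a^q) is an endomorphism moving x to x + y; it is
    injective when x + y is not in I. If the ideal I is nonzero, it contains
    such a nonzero y. If I = 0, then y = u x works as soon as u and u + 1 are
    both units, and otherwise R = {0, 1, x, 1 + x} with 2 = x^2 = 0.

    If M = pR, the subring of R x R generated by the pairs (t, t^p) with
    t^q = t is the graph of an automorphism lifting the Frobenius. If it is the
    identity, then x^p = x modulo M for all x, so that every element is congruent
    modulo p, hence is equal, to an integer multiple of 1. *)

(** * Subrings and the binomial formula for p-power exponents *)

Definition subring_pred (A : comNzRingType) (P : A -> Prop) :=
  [/\ P 1, forall x y, P x -> P y -> P (x - y)
         & forall x y, P x -> P y -> P (x * y)].

Section SubringPred.
Variables (A : comNzRingType) (P : A -> Prop) (subringP : subring_pred P).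

Lemma subring_pred0 : P 0.
Proof. by case: subringP => P1 PB _; rewrite -(subrr 1); apply: PB. Qed.

Lemma subring_predD x y : P x -> P y -> P (x + y).
Proof.
case: subringP => _ PB _ Px Py; rewrite -[y]opprK -[- y]sub0r.
by apply: (PB) => //; apply: (PB) => //; apply: subring_pred0.
Qed.

Lemma subring_predX x n : P x -> P (x ^+ n).
Proof.
case: subringP => P1 _ PM Px; elim: n => [|n IHn] //.
by rewrite exprS; apply: PM.
Qed.

Lemma subring_predMn x n : P x -> P (x *+ n).
Proof.
move=> Px; elim: n => [|n IHn]; first exact: subring_pred0.
by rewrite mulrS; apply: subring_predD.
Qed.

Lemma subring_pred_nat n : P n%:R.
Proof. by apply: subring_predMn; case: subringP. Qed.

Variables (p : nat) (p_pr : prime p).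

(** The inner binomial coefficients are divisible by p. Keeping [h] inside [P] is what
    [frob_graph_fixed] relies on later. *)
Lemma exprD_prime x y : P x -> P y ->
  exists2 h, P h & (x + y) ^+ p = x ^+ p + y ^+ p + p%:R * h.
Proof.
case: subringP => P1 PB PM Px Py.
case: p p_pr => // n n_pr.
exists (\sum_(i < n) (x ^+ (n - i) * y ^+ i.+1) *+ ('C(n.+1, i.+1) %/ n.+1)).
  apply: big_ind => [|u v|i _]; [exact: subring_pred0|exact: subring_predD|].
  by apply: subring_predMn; apply: PM; apply: subring_predX.
rewrite exprDn big_ord_recl big_ord_recr /= !subn0 !bin0 !expr0 mulr1.
rewrite /bump /= !add1n subnn binn expr0 mul1r !mulr1n [RHS]addrAC -addrA.
congr (_ + (_ + _)); rewrite mulr_sumr; apply: eq_bigr => i _.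
rewrite add1n subSS mulr_natl -mulrnA divnK //.
by apply: prime_dvd_bin => //=; rewrite ltnS ltn_ord.
Qed.

Lemma exprD_primepow m x y : P x -> P y ->
  exists2 h, P h &
    (x + y) ^+ (p ^ m) = x ^+ (p ^ m) + y ^+ (p ^ m) + p%:R * h.
Proof.
case: subringP => P1 PB PM Px Py.
elim: m => [|m [h Ph IHm]].
  by exists 0; [exact: subring_pred0 | rewrite !expn0 !expr1 mulr0 addr0].
have Pxm := subring_predX (p ^ m) Px; have Pym := subring_predX (p ^ m) Py.
rewrite !expnSr !exprM IHm.
have Pp := subring_pred_nat p.
have [h1 Ph1 ->] := exprD_prime (subring_predD Pxm Pym) (PM _ _ Pp Ph).
have [h2 Ph2 ->] := exprD_prime Pxm Pym.
(* The terms come from the p-th power of x^(p^m) + y^(p^m), from (p h)^p, and from adding p h,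
   respectively. *)
exists (h2 + p%:R ^+ p.-1 * h ^+ p + h1).
  by do ![apply: subring_predD | apply: (PM) | apply: subring_predX].
have pE : p%:R ^+ p = p%:R * p%:R ^+ p.-1 :> A.
  by rewrite -exprS prednK ?prime_gt0.
by rewrite exprMn pE !mulrDr !mulrA !addrA.
Qed.

End SubringPred.

(** Pigeonhole; used for the multiples of 1, the powers of an element and the iterates of the p-th
    power map. *)
Lemma seq_collision (T : finType) (f : nat -> T) :
  exists i j, (i < j)%N /\ f i = f j.
Proof.
have /injectivePn[i [j neq_ij eq_ij]] : ~~ injectiveb (fun i : 'I_#|T|.+1 => f i).
  by apply/injectiveP => /leq_card; rewrite card_ord ltnn.
case: (ltngtP i j) => [lt_ij|lt_ji|/val_inj e]; first by exists i, j.
  by exists j, i.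
by rewrite e eqxx in neq_ij.
Qed.

(** * Ideals of a finite ring *)

Section Ideal.
Variables (R : finComNzRingType) (I : {set R}) (idealI : idealr_closed I).

Lemma ideal0 : 0 \in I.
Proof. by case: idealI. Qed.

Lemma idealD x y : x \in I -> y \in I -> x + y \in I.
Proof. by case: idealI => _ _ I_lin Ix Iy; rewrite -[x]mul1r I_lin. Qed.

Lemma idealMl a x : x \in I -> a * x \in I.
Proof.
by case: idealI => I0 _ I_lin Ix; rewrite -[a * x]addr0 I_lin.
Qed.

Lemma idealMr a x : x \in I -> x * a \in I.
Proof. by rewrite mulrC; apply: idealMl. Qed.

Lemma idealN x : x \in I -> - x \in I.
Proof. by rewrite -mulN1r; apply: idealMl. Qed.

Lemma idealB x y : x \in I -> y \in I -> x - y \in I.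
Proof. by move=> Ix /idealN; apply: idealD. Qed.

Lemma idealDl x y : y \in I -> (x + y \in I) = (x \in I).
Proof.
move=> Iy; apply/idP/idP => [Ixy|Ix]; last exact: idealD.
by rewrite -[x](addrK y); apply: idealB.
Qed.

Lemma idealX x n : (0 < n)%N -> x \in I -> x ^+ n \in I.
Proof. by case: n => // n _ Ix; rewrite exprS; apply: idealMr. Qed.

Lemma ideal_ann x r s : (forall m, m \in I -> x * m = 0) ->
  r - s \in I -> r * x = s * x.
Proof.
by move=> xI0 /xI0 e; apply/eqP; rewrite -subr_eq0 -mulrBl mulrC e.
Qed.

End Ideal.

(** The boolean form lets [maxset] select maximal ideals. *)
Definition idealrb (R : finComNzRingType) (I : {set R}) : bool :=
  [&& 0 \in I, 1 \notin I &
      [forall a, forall u in I, forall v in I, a * u + v \in I]].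

Lemma idealrbP (R : finComNzRingType) (I : {set R}) :
  reflect (idealr_closed I) (idealrb I).
Proof.
apply: (iffP and3P) => -[I0 I1 I_lin]; split=> //.
  by move=> a u v Iu Iv; move/forallP/(_ a)/forall_inP/(_ u Iu)/forall_inP: I_lin; apply.
by apply/forallP => a; apply/forall_inP => u Iu; apply/forall_inP => v Iv; apply: I_lin.
Qed.

(** A noninvertible [x] generates a proper ideal, which lies in some maximal ideal, and this is [M]
    by uniqueness. *)
Lemma local_ring_unit (R : finComNzRingType) (M : {set R}) x :
  local_ring M -> x \notin M -> exists y, y * x = 1.
Proof.
case=> _ M_uniq M'x; case: (pickP (fun y => y * x == 1)) => [y /eqP|no_inv].
  by exists y.
pose I := [set y * x | y : R].
have /idealrbP/maxset_exists[N /maxsetP[/idealrbP idealN maxN] sIN] : idealr_closed I.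
  split.
  - by apply/imsetP; exists 0; rewrite ?mul0r.
  - by apply/negP => /imsetP[y _ e]; move: (no_inv y); rewrite -e eqxx.
  - move=> a _ _ /imsetP[u _ ->] /imsetP[v _ ->].
    by apply/imsetP; exists (a * u + v); rewrite // mulrDl mulrA.
case/negP: M'x; rewrite -(M_uniq N); last first.
  by split=> // J /idealrbP idealJ; apply: maxN.
by apply: (subsetP sIN); apply/imsetP; exists 1; rewrite ?mul1r.
Qed.

(** * Residue characteristic, nilpotency and Teichmüller representatives *)

Section Local.
Variables (R : finComNzRingType) (M : {set R}).
Hypothesis idealM : idealr_closed M.
Hypothesis unitM : forall x, x \notin M -> exists y, y * x = 1.

Lemma max_prime x y : x * y \in M -> (x \in M) || (y \in M).
Proof.
case: (boolP (x \in M)) => //= /unitM[z zx] Mxy.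
by rewrite -[y]mul1r -zx -mulrA (idealMl idealM).
Qed.

Lemma max_primeX x n : x ^+ n \in M -> x \in M.
Proof.
elim: n => [|n IHn]; first by case: idealM => _ /negP.
by rewrite exprS => /max_prime/orP[|/IHn].
Qed.

(** A one-element Nakayama argument: [1 - m] is a unit. *)
Lemma max_fix_eq0 x m : m \in M -> x = m * x -> x = 0.
Proof.
move=> Mm e; have /unitM[y y1] : 1 - m \notin M.
  by rewrite (idealDl idealM) ?(idealN idealM) //; case: idealM.
by rewrite -[x]mul1r -y1 -mulrA mulrBl mul1r -e subrr mulr0.
Qed.

(** Two multiples of 1 coincide, so a positive integer lies in [M]; as [M] is prime, splitting off
    prime factors reaches a prime in [M]. *)
Lemma max_pchar : exists2 p, prime p & p%:R \in M.
Proof.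
have [n n_gt0 Mn] : exists2 n, (0 < n)%N & n%:R \in M.
  have [i [j [lt_ij eq_ij]]] := seq_collision (fun n => n%:R : R).
  exists (j - i)%N; first by rewrite subn_gt0.
  by rewrite natrB ?(ltnW lt_ij) // eq_ij subrr (ideal0 idealM).
elim/ltn_ind: n n_gt0 Mn => n IHn n_gt0 Mn.
case: (leqP n 1) => [n_le1|n_gt1].
  move: Mn; have -> : n = 1%N by apply/eqP; rewrite eqn_leq n_le1.
  by case: idealM => _ /negP.
move: Mn; have /dvdnP[m nE] := pdiv_dvd n; rewrite nE natrM.
case/max_prime/orP => [Mm|]; last by exists (pdiv n); rewrite ?pdiv_prime.
have m_gt0 : (0 < m)%N by move: n_gt0; rewrite nE muln_gt0 => /andP[].
apply: (IHn m) => //; rewrite [X in (_ < X)%N]nE ltn_Pmulr //.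
exact: prime_gt1 (pdiv_prime n_gt1).
Qed.

(** A coincidence x^i = x^j with i < j reads x^i = x^(j-i) x^i, where x^(j-i) is in [M]. *)
Lemma max_nilpotent x : x \in M -> exists n, x ^+ n = 0.
Proof.
move=> Mx; have [i [j [lt_ij eq_ij]]] := seq_collision (fun n => x ^+ n).
exists i; apply: (max_fix_eq0 (m := x ^+ (j - i))).
  by apply: (idealX idealM); rewrite ?subn_gt0.
by rewrite -exprD subnK // ltnW.
Qed.

Variables (p : nat) (p_pr : prime p) (Mp : p%:R \in M).

Lemma subring_predT : subring_pred (fun _ : R => True).
Proof. by []. Qed.

Lemma frobD m x y : exists h : R,
  (x + y) ^+ (p ^ m) = x ^+ (p ^ m) + y ^+ (p ^ m) + p%:R * h.
Proof.
have [h _ E] := exprD_primepow subring_predT p_pr m (x := x) (y := y) I I.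
by exists h.
Qed.

Lemma frob_max m x y : (x + y) ^+ (p ^ m) - (x ^+ (p ^ m) + y ^+ (p ^ m)) \in M.
Proof.
have [h ->] := frobD m x y; by rewrite addrC addKr (idealMr idealM).
Qed.

(** If x^(p^i) = x^(p^j) for all x and d = j - i, then (x^(p^d) - x)^(p^i) is congruent to x^(p^j) -
    x^(p^i) = 0 modulo [M], and [M] is prime. *)
Lemma teichmuller_exponent : exists d, [/\ (0 < d)%N,
  forall x, x ^+ (p ^ d) - x \in M &
  forall x, exists2 t, t ^+ (p ^ d) = t & x - t \in M].
Proof.
have [i [j [lt_ij eq_ij]]] := seq_collision (fun n => [ffun x : R => x ^+ (p ^ n)]).
have {}eq_ij (x : R) : x ^+ (p ^ i) = x ^+ (p ^ j) by move/ffunP/(_ x): eq_ij; rewrite !ffunE.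
set d := (j - i)%N; have d_gt0 : (0 < d)%N by rewrite subn_gt0.
have fixM (x : R) : x ^+ (p ^ d) - x \in M.
  apply: (max_primeX (n := p ^ i)).
  have := frob_max i (x ^+ (p ^ d) - x) x.
  rewrite subrK -exprM -expnD subnK ?(ltnW lt_ij) // -eq_ij opprD addrCA subrr addr0.
  by move/(idealN idealM); rewrite opprK.
exists d; split=> // x.
have fixMn n : x - x ^+ (p ^ (d * n)) \in M.
  elim: n => [|n IHn]; first by rewrite muln0 expr1 subrr (ideal0 idealM).
  rewrite mulnS addnC expnD exprM -[x in x - _](subrK (x ^+ (p ^ (d * n)))) -addrA.
  by apply: (idealD idealM) => //; rewrite -opprB (idealN idealM).
(* As a multiple of d, the exponent d i keeps the power congruent to x; being at least i, it lies
   where the iterates of the p-th power map have period d. *)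
exists (x ^+ (p ^ (d * i))) => //.
rewrite -exprM -expnD.
have -> : (d * i + d = j + (d * i - i))%N.
  by rewrite -(subnK (ltnW lt_ij)) -/d -addnA subnKC ?leq_pmull // addnC.
by rewrite expnD exprM -eq_ij -exprM -expnD subnKC // leq_pmull.
Qed.

(** * The automorphism a |-> a + phi (a - a^q) *)

Section Shear.
Variables (d : nat) (d_gt0 : (0 < d)%N).
Hypothesis fixM : forall x, x ^+ (p ^ d) - x \in M.
Variables (I : {set R}) (idealI : idealr_closed I) (Ip : p%:R \in I).
Hypothesis sMMI : forall m n, m \in M -> n \in M -> m * n \in I.
Variables (x y : R) (Mx : x \in M) (My : y \in M).
Hypothesis MIx : forall m, m \in M -> exists r, m - r * x \in I.
Hypothesis yM0 : forall m, m \in M -> y * m = 0.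
Hypothesis I'xy : x + y \notin I.

Let q := (p ^ d)%N.
(** [coef m * y] is phi(m). For m in [M] a suitable r exists by [MIx], so the default 0 is not
    reached there. *)
Let coef (a : R) := odflt 0 [pick r | a - r * x \in I].
Let D (a : R) := a - a ^+ q.
Let shear a := a + coef (D a) * y.

Let q_gt1 : (1 < q)%N.
Proof. by rewrite -(expn0 p) ltn_exp2l ?prime_gt1. Qed.

Let MD a : D a \in M.
Proof. by rewrite /D -opprB (idealN idealM). Qed.

Let coefP m : m \in M -> m - coef m * x \in I.
Proof.
move/MIx=> [r Ir]; rewrite /coef.
by case: pickP => //= no_r; rewrite no_r in Ir.
Qed.

(** Two coefficients of [m] differ by an element of [M], since a unit difference would put [x] in
    [I]; and [y] kills [M]. *)
Let coefE m r : x \notin I -> m \in M -> m - r * x \in I -> coef m * y = r * y.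
Proof.
move=> I'x Mm Ir; apply: (ideal_ann yM0); apply: contraNT I'x.
case/unitM => z zE; rewrite -[x]mul1r -zE -mulrA (idealMl idealI) //.
have -> : (coef m - r) * x = m - r * x - (m - coef m * x) by ring.
exact: (idealB idealI) Ir (coefP Mm).
Qed.

Let IMX a : a \in M -> a ^+ q \in I.
Proof.
move=> Ma; case: q q_gt1 => [|[|n]] // _.
by rewrite exprS sMMI // (idealX idealM).
Qed.

Lemma shear_automorphism : x \notin I ->
  exists s : {rmorphism R -> R}, bijective s /\ s x = x + y.
Proof.
move=> I'x; have coef_y := coefE I'x.
have shearB : zmod_morphism shear.
  move=> a b; rewrite /shear.
  rewrite (coef_y _ (coef (D a) - coef (D b))) //; first by ring.
  (* Expanding a^q as ((a - b) + b)^q shows that [D] is additive up to p h, which lies in [I]. *)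
  have [h] := frobD d (a - b) b.
  rewrite subrK -/q => qE.
  have -> : D (a - b) - (coef (D a) - coef (D b)) * x =
    D a - coef (D a) * x - (D b - coef (D b) * x) + p%:R * h.
    by rewrite /D qE; ring.
  apply: (idealD idealI); last exact: (idealMr idealI).
  by apply: (idealB idealI); apply: coefP.
have shearM : monoid_morphism shear.
  split=> [|a b]; rewrite /shear.
    rewrite (coef_y _ 0) ?mul0r ?addr0 //.
    by rewrite /D expr1n subrr sub0r oppr0 (ideal0 idealI).
  rewrite (coef_y _ (a * coef (D b) + b * coef (D a))) //.
    have yy : y * y = 0 by exact: yM0.
    transitivity (a * b + (a * coef (D b) + b * coef (D a)) * y
      + coef (D a) * coef (D b) * (y * y)); first by rewrite yy; ring.
    by ring.
  (* The Leibniz rule holds up to D b D a, a product of two elements of [M], hence in [I]. *)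
  have -> : D (a * b) - (a * coef (D b) + b * coef (D a)) * x =
    a * (D b - coef (D b) * x) + b * (D a - coef (D a) * x) - D b * D a.
    by rewrite /D exprMn; ring.
  apply: (idealB idealI); last exact: sMMI.
  by apply: (idealD idealI); apply: (idealMl idealI); apply: coefP.
pose shear_zmod := GRing.isZmodMorphism.Build R R shear shearB.
pose shear_mon := GRing.isMonoidMorphism.Build R R shear shearM.
pose s : {rmorphism R -> R} := HB.pack shear shear_zmod shear_mon.
exists s; split; last first.
  (* D x - x = - x^q lies in [I], so phi (D x) = y. *)
  rewrite /= /shear (coef_y _ 1) ?mul1r //.
  rewrite /D addrAC subrr add0r.
  by rewrite (idealN idealI) // IMX.
apply: injF_bij; apply: raddf_inj => a /= /eqP; rewrite /shear addr_eq0 => /eqP aE.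
(* Let r = [coef (D a)], so a = - r y. If r is in [M], then a = 0. If r is a unit, then a is in [M],
   a^q is in [I], and D a = r x modulo [I] yields r (x + y) in [I], a contradiction. *)
case: (boolP (coef (D a) \in M)) => [Mr|/unitM[z zr]].
  by rewrite aE mulrC yM0 ?oppr0.
have Ma : a \in M by rewrite aE (idealN idealM) ?(idealMl idealM).
case/negP: I'xy; rewrite -[x + y]mul1r -zr -mulrA (idealMl idealI) //.
have -> : coef (D a) * (x + y) = - (D a - coef (D a) * x) - a ^+ q.
  by rewrite /D {3}aE; ring.
by apply: (idealB idealI); rewrite ?IMX // (idealN idealI) // coefP.
Qed.

End Shear.

End Local.

(** Homomorphisms out of Z_n and F_2[X]/(X^2) are easy to write, so isomorphisms from [A] are
    obtained by inverting maps into [A]. *)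
Lemma ring_isomorphic_sym_surj (A : finNzRingType) (B : nzRingType)
    (g : {rmorphism B -> A}) :
  injective g -> (forall a, exists b, g b = a) -> ring_isomorphic A B.
Proof.
move=> g_inj /fin_all_exists[f fK].
have gK : cancel g f by move=> b; apply: g_inj; rewrite fK.
pose fZ := GRing.isZmodMorphism.Build A B f (can2_zmod_morphism gK fK).
pose fM := GRing.isMonoidMorphism.Build A B f (can2_monoid_morphism gK fK).
pose f' : {rmorphism A -> B} := HB.pack f fZ fM.
by exists f'; exists g.
Qed.

(** * The case M <> pR *)

Section NonPrincipal.
Variables (R : finComNzRingType) (M : {set R}).
Hypothesis idealM : idealr_closed M.
Hypothesis unitM : forall x, x \notin M -> exists y, y * x = 1.

(** Take a nonzero [y] in [I] with R y smallest. If y m <> 0, then R y m = R y, so y = r m y for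
    some r, and y vanishes. *)
Lemma ideal_socle (I : {set R}) z : idealr_closed I -> z \in I -> z != 0 ->
  exists y, [/\ y \in I, y != 0 & forall m, m \in M -> y * m = 0].
Proof.
move=> idealI Iz z0.
pose multiples y := [set y * r | r : R].
case: (@arg_minnP _ z (fun y => (y \in I) && (y != 0)) (fun y => #|multiples y|)).
  by rewrite Iz.
move=> y /andP[Iy y0] min_y; exists y; split=> // m Mm.
apply/eqP/negPn/negP => ym0.
have sub : multiples (y * m) \subset multiples y.
  apply/subsetP => _ /imsetP[r _ ->]; apply/imsetP; exists (m * r) => //.
  by rewrite mulrA.
have := min_y (y * m); rewrite (idealMr idealI) // ym0 => /(_ isT) le_y.
have /imsetP[r _ yE] : y \in multiples (y * m).
  have /eqP -> : multiples (y * m) == multiples y by rewrite eqEcard sub.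
  by apply/imsetP; exists 1; rewrite ?mulr1.
case/eqP: y0; apply: (max_fix_eq0 idealM unitM (m := m * r)).
  exact: (idealMr idealM).
by rewrite {1}yE mulrC mulrA [r * y]mulrC; ring.
Qed.

Section MaximalSubideal.
Variables (I : {set R}) (idealI : idealr_closed I).
Hypotheses (sIM : I \subset M).
Hypothesis maxI : forall J : {set R}, idealr_closed J -> I \subset J ->
  J \proper M -> J = I.

(** I + R x is an ideal inside [M] strictly above [I], hence equals [M] by maximality. *)
Lemma max_subideal_gen x m : x \in M -> x \notin I -> m \in M ->
  exists r, m - r * x \in I.
Proof.
move=> Mx I'x Mm.
pose J := [set u | [exists r, u - r * x \in I]].
have JP u : reflect (exists r, u - r * x \in I) (u \in J).
  by rewrite inE; apply: existsP.
have sJM : J \subset M.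
  apply/subsetP => u /JP[r /(subsetP sIM) Mur].
  by rewrite -[u](subrK (r * x)) (idealD idealM) // (idealMl idealM).
have idealJ : idealr_closed J.
  split.
  - by apply/JP; exists 0; rewrite mul0r subrr (ideal0 idealI).
  - by apply: contra (subsetP sJM 1) _; case: idealM.
  move=> a u v /JP[r Ir] /JP[s Is]; apply/JP; exists (a * r + s).
  have -> : a * u + v - (a * r + s) * x = a * (u - r * x) + (v - s * x) by ring.
  by rewrite (idealD idealI) // (idealMl idealI).
have sIJ : I \subset J.
  by apply/subsetP => u Iu; apply/JP; exists 0; rewrite mul0r subr0.
have Jx : x \in J by apply/JP; exists 1; rewrite mul1r subrr (ideal0 idealI).
apply/JP; move: Mm; apply/subsetP; apply: contraNT I'x => nsMJ.
by rewrite -(maxI idealJ sIJ) // properE sJM.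
Qed.

(** If m n were outside [I], then n - r m n would be in [I] for some r; as 1 - r m is a unit, n and
    then m n would be in [I]. *)
Lemma max_subideal_mul m n : m \in M -> n \in M -> m * n \in I.
Proof.
move=> Mm Mn; case: (boolP (n \in I)) => [In|I'n]; first exact: (idealMl idealI).
apply: contraNT (I'n) => I'mn.
have [r Ir] := max_subideal_gen (idealMl idealM m Mn) I'mn Mn.
have /unitM[z zE] : 1 - r * m \notin M.
  by rewrite (idealDl idealM) ?(idealN idealM) ?(idealMl idealM) //; case: idealM.
rewrite -[n]mul1r -zE -mulrA (idealMl idealI) //.
by rewrite mulrBl mul1r -mulrA.
Qed.

End MaximalSubideal.

Hypothesis rigid : forall s : {rmorphism R -> R}, bijective s -> forall x, s x = x.

(* The conclusion describes F_2[X]/(X^2), with x the class of X. *)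
Lemma rigid_nonprincipal p : prime p -> (p%:R : R) \in M ->
    (exists2 m, m \in M & forall y : R, m != p%:R * y) ->
  exists x : R, [/\ x != 0, x * x = 0, 2%:R = 0 :> R &
                forall a : R, exists i j : bool, a = i%:R + j%:R * x].
Proof.
move=> p_pr Mp [w Mw w_indiv].
have [d [d_gt0 fixM _]] := teichmuller_exponent idealM unitM p_pr Mp.
pose P (J : {set R}) := [&& idealrb J, p%:R \in J & J \proper M].
have /maxset_exists[I /maxsetP[/and3P[/idealrbP idealI Ip ltIM] maxP] _] :
    P [set p%:R * y | y : R].
  have sub : [set p%:R * y | y : R] \subset M.
    by apply/subsetP => _ /imsetP[y _ ->]; apply: (idealMr idealM).
  apply/and3P; split.
  - apply/idealrbP; split.
    + by apply/imsetP; exists 0; rewrite ?mulr0.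
    + by apply: contra (subsetP sub 1) _; case: idealM.
    move=> a _ _ /imsetP[u _ ->] /imsetP[v _ ->]; apply/imsetP.
    by exists (a * u + v) => //; ring.
  - by apply/imsetP; exists 1; rewrite ?mulr1.
  rewrite properE sub; apply/subsetPn; exists w => //.
  by apply/negP => /imsetP[y _ /eqP]; apply/negP.
have sIM := proper_sub ltIM; have [x Mx I'x] := subsetPn (proper_subn ltIM).
have maxI (J : {set R}) : idealr_closed J -> I \subset J -> J \proper M -> J = I.
  move=> /idealrbP idealJ sIJ ltJM; apply: maxP => //.
  by rewrite /P idealJ (subsetP sIJ).
have MIx m := @max_subideal_gen _ idealI sIM maxI _ m Mx I'x.
have sMMI := max_subideal_mul idealI sIM maxI.
have shear_I y : y \in M -> y != 0 -> (forall m, m \in M -> y * m = 0) ->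
    x + y \in I.
  move=> My y0 yM0; apply: contraNT y0 => I'xy.
  have [s [bij_s sx]] := shear_automorphism idealM unitM p_pr d_gt0 fixM
    idealI Ip sMMI Mx My MIx yM0 I'xy I'x.
  by rewrite -(inj_eq (addrI x)) -sx rigid // addr0.
have I0 z : z \in I -> z = 0.
  move=> Iz; apply/eqP/negPn/negP => z0.
  have [y [Iy y0 yM0]] := ideal_socle idealI Iz z0.
  have := shear_I y (subsetP sIM _ Iy) y0 yM0.
  by rewrite (idealDl idealI) //; apply/negP.
have x0 : x != 0 by apply: contraNneq I'x => ->; apply: (ideal0 idealI).
(* The residue field is F_2: if u and u + 1 were units, y = u x would be nonzero and killed by [M],
   because MM <= I = 0. Then x + y = (u + 1) x would be in I = 0, forcing x = 0. *)
have unit1 u : u \notin M -> u + 1 \in M.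
  move=> M'u; apply: contraNT (x0) => /unitM[z zu1].
  have [v vu] := unitM M'u.
  have ux0 : u * x != 0.
    by apply: contraNneq (x0) => ux0; rewrite -[x]mul1r -vu -mulrA ux0 mulr0.
  have := shear_I (u * x) (idealMl idealM _ Mx) ux0.
  have -> : x + u * x = (u + 1) * x by ring.
  move=> shu; rewrite -[x]mul1r -zu1 -mulrA (I0 ((u + 1) * x)) ?mulr0 //.
  by apply: shu => m Mm; rewrite -mulrA (I0 (x * m)) ?mulr0 // sMMI.
(* 2 = 1 + 1 is in [M] by [unit1], and p = 0 because I = 0. For odd p, 1 = p - 2 (p - 1)/2 would be
   in [M]. *)
have two0 : 2%:R = 0 :> R.
  have M2 : 2%:R \in M by apply: unit1; case: idealM.
  have p0 := I0 _ Ip; case: (even_prime p_pr) => [p2|odd_p].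
    by apply: I0; rewrite -p2.
  have : 1 \notin M by case: idealM.
  have -> : 1 = - (p./2%:R * 2%:R) :> R.
    apply/eqP; rewrite -addr_eq0 -natrM muln2 nat1r.
    by rewrite -add1n -[1%N]/(nat_of_bool true) -odd_p odd_double_half p0.
  by rewrite (idealN idealM) // (idealMl idealM).
have MP m : m \in M -> exists j : bool, m = j%:R * x.
  move=> Mm; have [r /I0/eqP] := MIx m Mm; rewrite subr_eq0 => /eqP ->.
  case: (boolP (r \in M)) => [Mr|/unit1 Mr1].
    by exists false; rewrite mul0r; apply: I0; apply: sMMI.
  (* Here r acts on x as 1: r + 1 is in [M], so it kills x, and 2 = 0. *)
  exists true; rewrite mul1r; apply/eqP; rewrite -subr_eq0.
  have -> : r * x - x = (r + 1) * x - 2%:R * x by ring.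
  by rewrite two0 mul0r subr0 (I0 _ (sMMI _ _ Mr1 Mx)).
exists x; split=> // [|a]; first exact/I0/sMMI.
case: (boolP (a \in M)) => [/MP[j ->]|/unit1/MP[j aE]].
  by exists false, j; rewrite add0r.
exists true, j; rewrite -aE.
have -> : 1 + (a + 1) = a + 2%:R by ring.
by rewrite two0 addr0.
Qed.

End NonPrincipal.

(** * Identification with Z_(p^b) and F_2[X]/(X^2) *)

Lemma Zp_rmorphism (R : nzRingType) n : (1 < n)%N -> n%:R = 0 :> R ->
  exists c : {rmorphism 'Z_n -> R}, forall i, c i = (i : nat)%:R.
Proof.
move=> n_gt1 n0.
(* Arithmetic in ['Z_n] is modulo [(Zp_trunc n).+2], which is n only for n > 1. *)
have mod_n k : (k %% (Zp_trunc n).+2)%N%:R = k%:R :> R.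
  by rewrite Zp_cast // [in RHS](divn_eq k n) natrD natrM n0 mulr0 add0r.
pose f (i : 'Z_n) : R := (i : nat)%:R.
have fD : nmod_morphism f.
  by split=> [|i j]; rewrite /f //= mod_n natrD.
have fM : monoid_morphism f.
  by split=> [|i j]; rewrite /f //= mod_n natrM.
pose fDi := GRing.isNmodMorphism.Build _ _ f fD.
pose fMi := GRing.isMonoidMorphism.Build _ _ f fM.
pose c : {rmorphism 'Z_n -> R} := HB.pack f fDi fMi.
by exists c.
Qed.

(** Evaluation at [x], with coefficients sent along Z_2 -> R, kills X^2 and so respects the product
    of remainders in the quotient. *)
Lemma ring_isomorphic_dual_numbers (R : finComNzRingType) (x : R) :
    x != 0 -> x * x = 0 -> 2%:R = 0 :> R ->
    (forall a : R, exists i j : bool, a = i%:R + j%:R * x) ->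
  ring_isomorphic R {poly %/ ('X^2 : {poly 'Z_2})}.
Proof.
move=> x0 xx0 two0 xP.
have [c cE] := Zp_rmorphism (n := 2) isT two0.
pose ev (P : {poly 'Z_2}) := (map_poly c P).[x].
have evD P Q : ev (P + Q) = ev P + ev Q by rewrite /ev rmorphD hornerD.
have evM P Q : ev (P * Q) = ev P * ev Q by rewrite /ev rmorphM hornerM.
have evX2 P : ev (P * mk_monic 'X^2) = 0.
  by rewrite mk_monic_X2 evM {2}/ev map_polyXn hornerXn expr2 xx0 mulr0.
have ev_mod S : ev (Pdiv.CommonRing.rmodp S (mk_monic 'X^2)) = ev S.
  have {2}-> := Pdiv.RingMonic.rdivp_eq (monic_mk_monic 'X^2) S.
  by rewrite evD evX2 add0r.
pose g (P : {poly %/ ('X^2 : {poly 'Z_2})}) := ev (val P).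
have gD : nmod_morphism g.
  split=> [|P Q]; last by rewrite /g -evD.
  by rewrite /g /ev /= rmorph0 horner0.
have gM : monoid_morphism g.
  split=> [|P Q]; first by rewrite /g /ev /= rmorph1 hornerC.
  by rewrite /g -evM [val (P * Q)]poly_of_qpolyM ev_mod.
pose gDi := GRing.isNmodMorphism.Build _ _ g gD.
pose gMi := GRing.isMonoidMorphism.Build _ _ g gM.
pose g' : {rmorphism _ -> R} := HB.pack g gDi gMi.
have size_mk_X2 : size (mk_monic ('X^2 : {poly 'Z_2})) = 3.
  by rewrite mk_monic_X2 size_polyXn.
have size_le P : (size (val (P : {poly %/ ('X^2 : {poly 'Z_2})})) <= 2)%N.
  by rewrite -ltnS; apply: leq_trans (size_mk_monic P) _; rewrite size_mk_X2.
have gE P : g P = c (val P)`_0 + c (val P)`_1 * x.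
  have sz : (size (map_poly c (val P)) <= 2)%N.
    by apply: leq_trans (size_le P); apply: size_poly.
  rewrite /g /ev (horner_coef_wide _ sz) !big_ord_recl big_ord0 /= !coef_map.
  by rewrite expr0 expr1 mulr1 addr0.
apply: (@ring_isomorphic_sym_surj _ _ g').
  apply: raddf_inj => P /= gP0; apply/val_inj/polyP => i /=; rewrite coef0.
  case: (ltnP 1 i) => [i_gt1|]; first by rewrite nth_default // (leq_trans (size_le P)).
  have x_unit (u : 'Z_2) : c u * x = 0 -> u = 0.
    rewrite cE; case: u => [[|[|//]]] u2 //= ; first by move=> _; apply: val_inj.
    by rewrite mul1r => /eqP; rewrite (negPf x0).
  (* Multiplying c0 + c1 x = 0 by x isolates c0, since x^2 = 0. *)
  have P0 : (val P)`_0 = 0.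
    apply: x_unit; have := congr1 (fun z => z * x) gP0.
    by rewrite gE mul0r mulrDl -[_ * x * x]mulrA xx0 mulr0 addr0.
  have P1 : (val P)`_1 = 0.
    by apply: x_unit; move: gP0; rewrite gE P0 rmorph0 add0r.
  by case: i => [|[|]].
move=> a; have [i [j ->]] := xP a.
pose P : {poly 'Z_2} := j%:R%:P * 'X + i%:R%:P.
exists (in_qpoly 'X^2 P).
have sz : (size P < 3)%N.
  by rewrite size_MXaddC; case: ifP => // _; rewrite !ltnS size_polyC leq_b1.
have {}sz := leq_trans sz (eq_leq (esym size_mk_X2)).
have -> : g' (in_qpoly 'X^2 P) = ev P := congr1 ev (in_qpoly_small sz).
rewrite /ev rmorphD rmorphM /= !map_polyC /= map_polyX.
by rewrite !hornerE !rmorph_nat addrC.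
Qed.

(** The additive order n of 1 divides p^a, so n = p^b, with b > 0 because 1 <> 0. Z_n -> R is
    injective by minimality of n. *)
Lemma ring_isomorphic_Zp (R : finComNzRingType) p a : prime p ->
    p%:R ^+ a = 0 :> R -> (forall x : R, exists n, x = n%:R) ->
  exists b, (1 <= b)%N /\ ring_isomorphic R 'Z_(p ^ b).
Proof.
move=> p_pr pa0 natP.
have ex_n : exists n, (0 < n)%N && (n%:R == 0 :> R).
  by exists (p ^ a)%N; rewrite expn_gt0 prime_gt0 //= natrX pa0.
case: (ex_minnP ex_n) => n /andP[n_gt0 /eqP n0] min_n.
have n_dvd k : k%:R = 0 :> R -> (n %| k)%N.
  move=> k0; rewrite /dvdn eqn0Ngt; apply/negP => r_gt0.
  have r0 : (k %% n)%:R == 0 :> R.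
    by move/eqP: k0; rewrite {1}(divn_eq k n) natrD natrM n0 mulr0 add0r.
  by have := min_n (k %% n)%N; rewrite r_gt0 r0 leqNgt ltn_mod n_gt0 => /(_ isT).
have /dvdn_pfactor-/(_ p_pr)[b _ nE] : (n %| p ^ a)%N by apply: n_dvd; rewrite natrX.
have b_gt0 : (0 < b)%N.
  by case: b nE n0 => // -> /eqP; rewrite expn0 oner_eq0.
exists b; split=> //; rewrite -nE.
have n_gt1 : (1 < n)%N by rewrite nE -(expn0 p) ltn_exp2l ?prime_gt1.
have [c cE] := Zp_rmorphism n_gt1 n0.
apply: (@ring_isomorphic_sym_surj _ _ c).
  apply: raddf_inj => i ci0.
  have /n_dvd : (i : nat)%:R = 0 :> R by rewrite -cE; exact: ci0.
  rewrite /dvdn modn_small.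
    by move/eqP => i0; apply: val_inj.
  by have := ltn_ord i; rewrite [X in (_ < X)%N]Zp_cast.
move=> x; have [k ->] := natP x; exists k%:R; exact: rmorph_nat.
Qed.

(** Over F_p the product of the X - i is X^p - X, so the difference of the two integer polynomials
    has coefficients divisible by p; it is then evaluated at [x]. *)
Lemma prod_sub_nat_prime (R : comNzRingType) (p : nat) (x : R) : prime p ->
  exists h, \prod_(i < p) (x - i%:R) = x ^+ p - x + p%:R * h.
Proof.
move=> p_pr.
pose Q : {poly int} := \prod_(i < p) ('X - i%:R%:P) - ('X^p - 'X).
have Q0 : map_poly (intr : int -> 'F_p) Q = 0.
  rewrite /Q rmorphB rmorph_prod /= rmorphB /= map_polyXn map_polyX.
  have := finField_genPoly 'F_p; rewrite card_Fp // => ->.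
  apply/eqP; rewrite subr_eq0; apply/eqP.
  transitivity (\prod_(i < p) ('X - (i%:R : 'F_p)%:P)).
    by apply: eq_bigr => i _; rewrite rmorphB /= map_polyX map_polyC /= rmorph_nat.
  rewrite -(big_mkord xpredT (fun i => 'X - (i%:R : 'F_p)%:P)).
  rewrite -[X in \prod_(0 <= i < X) _](Fp_cast p_pr) big_mkord.
  by apply: eq_bigr => i _; rewrite natr_Zp.
have Qp i : (p %| Q`_i)%Z.
  have := congr1 (fun P : {poly 'F_p} => P`_i) Q0.
  by rewrite (dvdz_pcharf (pchar_Fp p_pr)) coef_map coef0 /= => ->.
exists (\sum_(i < size Q) (Q`_i %/ p)%Z%:~R * x ^+ i).
have : (map_poly intr Q).[x] = p%:R * \sum_(i < size Q) (Q`_i %/ p)%Z%:~R * x ^+ i.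
  rewrite (horner_coef_wide _ (size_poly _ _)) mulr_sumr; apply: eq_bigr => i _.
  by rewrite coef_map /= -{1}(divzK (Qp i)) intrM -pmulrn mulrA [p%:R * _]mulrC.
move=> <-; rewrite /Q rmorphB rmorph_prod /= rmorphB /= map_polyXn map_polyX.
rewrite !(hornerD, hornerN, hornerXn, hornerX) horner_prod addrC subrK; apply: eq_bigr => i _.
by rewrite rmorphB /= map_polyX map_polyC /= rmorph_nat !hornerE.
Qed.

(** * The subring of R x R generated by the pairs (t, t^p) *)

Inductive frob_graph (R : comNzRingType) (p q : nat) : R * R -> Prop :=
| FrobGen t : t ^+ q = t -> frob_graph p q (t, t ^+ p)
| FrobSub z w : frob_graph p q z -> frob_graph p q w -> frob_graph p q (z - w)
| FrobMul z w : frob_graph p q z -> frob_graph p q w -> frob_graph p q (z * w).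

Lemma frob_graph_subring (R : comNzRingType) p q :
  subring_pred (@frob_graph R p q).
Proof.
split; [|exact: FrobSub|exact: FrobMul].
have -> : 1 = (1, 1 ^+ p) :> R * R by rewrite expr1n.
by apply: FrobGen; rewrite expr1n.
Qed.

(** Generators satisfy z^q = z with q = p^d. The q-th power map is multiplicative, and additive up
    to p times an element of the subring, so the congruence propagates with [h] in the graph. *)
Lemma frob_graph_fixed (R : comNzRingType) p d z : prime p ->
    frob_graph p (p ^ d) z ->
  exists2 h : R * R, frob_graph p (p ^ d) h & z = z ^+ (p ^ d) + p%:R * h.
Proof.
move=> p_pr; have sub := @frob_graph_subring R p (p ^ d).
have [_ PB PM] := sub; have P0 := subring_pred0 sub.
elim=> [t tE|{}z w Gz [h Gh zE] Gw [k Gk wE]|{}z w Gz [h Gh zE] Gw [k Gk wE]].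
- exists 0 => //; rewrite mulr0 addr0.
  have -> : (t, t ^+ p) ^+ (p ^ d) = (t ^+ (p ^ d), t ^+ p ^+ (p ^ d)) :> R * R.
    by elim: (p ^ d)%N => // n IHn; rewrite !exprS IHn.
  by rewrite exprAC tE.
- have [e Ge] := exprD_primepow sub p_pr d (PB _ _ Gz Gw) Gw.
  rewrite subrK => E.
  exists (e + h - k); first by apply: (PB) => //; apply: subring_predD.
  rewrite {1}zE {1}wE E.
by move: ((z - w) ^+ _) (w ^+ _) => Z W; ring.
exists (z ^+ (p ^ d) * k + w * h).
  by apply: subring_predD; rewrite //; apply: (PM) => //; apply: subring_predX.
rewrite exprMn {1}zE mulrDl {1}wE.
by move: (z ^+ _) (w ^+ _) => Z W; ring.
Qed.

(** * Divisibility by powers of p, carried from one component to the other *)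

Section Transfer.
Variables (R : finComNzRingType) (M : {set R}).
Hypothesis idealM : idealr_closed M.
Hypothesis unitM : forall x, x \notin M -> exists y, y * x = 1.
Variables (p : nat) (p_pr : prime p).
Hypothesis Mgen : forall m, m \in M -> exists y, m = p%:R * y.
Variables (a : nat) (pa0 : p%:R ^+ a != 0 :> R) (pSa0 : p%:R ^+ a.+1 = 0 :> R).

Definition dvd_pow n (x : R) := exists y, x = p%:R ^+ n * y.

Lemma dvd_powD n x y : dvd_pow n x -> dvd_pow n y -> dvd_pow n (x + y).
Proof. by move=> [u ->] [v ->]; exists (u + v); rewrite mulrDr. Qed.

Lemma dvd_powN n x : dvd_pow n x -> dvd_pow n (- x).
Proof. by move=> [u ->]; exists (- u); rewrite mulrN. Qed.

Lemma dvd_pow_leq m n x : (m <= n)%N -> dvd_pow n x -> dvd_pow m x.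
Proof.
move=> le_mn [u ->]; exists (p%:R ^+ (n - m) * u).
by rewrite mulrA -exprD subnKC.
Qed.

(** Write x = p^n y with n < a. If y were a unit, p x = 0 would give p^(n+1) = 0, against p^a <> 0;
    so y is in [M], hence a multiple of p, and n can be raised. *)
Lemma dvd_pow_ann x : p%:R * x = 0 -> dvd_pow a x.
Proof.
move=> px0; suff H n : (n <= a)%N -> dvd_pow n x by exact: H.
elim: n => [_|n IHn lt_na]; first by exists x; rewrite mul1r.
have [y xE] := IHn (ltnW lt_na).
case: (boolP (y \in M)) => [/Mgen[z yE]|/unitM[z zy]].
  by exists z; rewrite xE yE mulrA -exprSr.
case/eqP: pa0; rewrite -(subnKC lt_na) exprD.
suff -> : p%:R ^+ n.+1 = 0 :> R by rewrite mul0r.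
rewrite -[LHS]mulr1 -[X in _ * X]zy; transitivity (z * (p%:R * (p%:R ^+ n * y))).
  by rewrite exprS; ring.
by rewrite -xE px0 mulr0.
Qed.

Lemma dvd_pow_max m n : m \in M -> dvd_pow n (m ^+ n).
Proof. by move=> /Mgen[y ->]; exists (y ^+ n); rewrite exprMn. Qed.

Variables (q : nat) (q_gt1 : (1 < q)%N).
Variable P : R * R -> Prop.
Hypothesis subringP : subring_pred P.
Hypothesis fixP : forall z, P z -> exists2 h, P h & z = z ^+ q + p%:R * h.
Hypothesis maxP : forall z, P z -> z.1 \in M -> z.2 \in M.

Lemma fix_iter n z : P z -> exists2 h, P h & z = z ^+ (q ^ n) + p%:R * h.
Proof.
move=> Pz; elim: n => [|n [h Ph zE]].
  by exists 0; [exact: subring_pred0 | rewrite mulr0 addr0].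
have [k Pk kE] := fixP (subring_predX subringP (q ^ n) Pz).
exists (k + h); first exact: subring_predD.
by rewrite {1}zE kE expnSr exprM mulrDr addrA.
Qed.

(* By [fix_iter], z = z^(q^(n+1)) + p h with h in P. Both components of
   z^(q^(n+1)) are divisible by p^(n+1), so that the claim for z at n + 1
   reduces to the claim for h at n. *)
Lemma dvd_pow_transfer n z : (n <= a.+1)%N -> P z ->
  dvd_pow n z.1 -> dvd_pow n z.2.
Proof.
elim: n z => [|n IHn] z lt_na Pz pz1; first by exists z.2; rewrite mul1r.
have Mp : p%:R \in M.
  apply: contraT => /unitM[y yp]; case/eqP: (oner_neq0 R).
  by rewrite -(expr1n _ a.+1) -yp exprMn pSa0 mulr0.
have Mz1 : z.1 \in M.
  by case: pz1 => y ->; rewrite exprS -mulrA (idealMr idealM).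
have Mz2 := maxP Pz Mz1.
have [h Ph zE] := fix_iter n.+1 Pz.
have le_q : (n.+1 <= q ^ n.+1)%N by rewrite ltnW // ltn_expl.
have z1E : z.1 = z.1 ^+ (q ^ n.+1) + p%:R * h.1.
  by rewrite {1}zE rmorphD rmorphXn rmorphM rmorph_nat.
have z2E : z.2 = z.2 ^+ (q ^ n.+1) + p%:R * h.2.
  by rewrite {1}zE rmorphD rmorphXn rmorphM rmorph_nat.
have [y ph1] : dvd_pow n.+1 (p%:R * h.1).
  have -> : p%:R * h.1 = z.1 - z.1 ^+ (q ^ n.+1) by rewrite {1}z1E addrC addKr.
  apply: dvd_powD => //; apply: dvd_powN.
  exact: dvd_pow_leq le_q (dvd_pow_max _ Mz1).
(* By [ph1], h.1 - p^n y is killed by p, hence divisible by p^a and so by p^n. *)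
have h1 : dvd_pow n h.1.
  rewrite -[h.1](subrK (p%:R ^+ n * y)); apply: dvd_powD; last by exists y.
  apply: (dvd_pow_leq (lt_na : (n <= a)%N)); apply: dvd_pow_ann.
  by rewrite mulrBr ph1 exprS mulrA subrr.
rewrite z2E; apply: dvd_powD.
  exact: dvd_pow_leq le_q (dvd_pow_max _ Mz2).
have [w ->] := IHn _ (ltnW lt_na) Ph h1.
by exists w; rewrite mulrA -exprS.
Qed.

(** The transfer at n = a + 1, where p^n = 0. The abstract [P] stands for the graph as well as for
    its transpose. *)
Lemma transfer_eq0 z : P z -> z.1 = 0 -> z.2 = 0.
Proof.
move=> Pz z1; have [|y ->] := dvd_pow_transfer (leqnn _) Pz.
  by exists 0; rewrite z1 mulr0.
by rewrite pSa0 mul0r.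
Qed.

End Transfer.

(** * The Frobenius lift in the case M = pR *)

Section Principal.
Variables (R : finComNzRingType) (M : {set R}).
Hypothesis idealM : idealr_closed M.
Hypothesis unitM : forall x, x \notin M -> exists y, y * x = 1.
Variables (p : nat) (p_pr : prime p) (Mp : (p%:R : R) \in M).
Hypothesis Mgen : forall m, m \in M -> exists y, m = p%:R * y.
Variables (d : nat) (d_gt0 : (0 < d)%N).
Hypothesis teichmuller : forall x, exists2 t, t ^+ (p ^ d) = t & x - t \in M.

Let G := @frob_graph R p (p ^ d).

Let subringG : subring_pred G := frob_graph_subring R p (p ^ d).

Let fixG z : G z -> exists2 h, G h & z = z ^+ (p ^ d) + p%:R * h.
Proof. exact: frob_graph_fixed. Qed.

Let nilp : exists2 a, p%:R ^+ a != 0 :> R & p%:R ^+ a.+1 = 0 :> R.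
Proof.
have [n pn0] := max_nilpotent idealM unitM Mp.
have ex_n : exists n, p%:R ^+ n == 0 :> R by exists n; apply/eqP.
case: (ex_minnP ex_n) => -[|a] /eqP pa0 min_a.
  by move/eqP: pa0; rewrite expr0 oner_eq0.
by exists a => //; apply/negP => /min_a; rewrite ltnn.
Qed.

(** This provides the hypothesis [maxP] of the transfer for the graph and, as [M] is prime, for its
    transpose. *)
Lemma frob_graph_mod z : G z -> z.2 - z.1 ^+ p \in M.
Proof.
elim=> [t _|{}z w _ IHz _ IHw|{}z w _ IHz _ IHw] /=.
- by rewrite subrr (ideal0 idealM).
- have := frob_max idealM p_pr Mp 1 (z.1 - w.1) w.1; rewrite expn1 subrK => Mzw.
  have -> : z.2 - w.2 - (z.1 - w.1) ^+ p = z.2 - z.1 ^+ p - (w.2 - w.1 ^+ p)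
      + (z.1 ^+ p - ((z.1 - w.1) ^+ p + w.1 ^+ p)).
    by move: ((z.1 - w.1) ^+ p) => u; ring.
  by rewrite (idealD idealM) // (idealB idealM).
have -> : z.2 * w.2 - (z.1 * w.1) ^+ p =
    (z.2 - z.1 ^+ p) * w.2 + z.1 ^+ p * (w.2 - w.1 ^+ p).
  by rewrite exprMn; ring.
by apply: (idealD idealM); [apply: (idealMr idealM)|apply: (idealMl idealM)].
Qed.

Let q_gt1 : (1 < p ^ d)%N.
Proof. by rewrite -(expn0 p) ltn_exp2l ?prime_gt1. Qed.

(** Since [G] is closed under subtraction, this makes [G] single-valued. *)
Lemma frob_graph_fun z : G z -> z.1 = 0 -> z.2 = 0.
Proof.
have [a pa0 pSa0] := nilp.
apply: (transfer_eq0 idealM unitM Mgen pa0 pSa0 q_gt1 subringG fixG).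
move=> {}z Gz Mz1; rewrite -[z.2](subrK (z.1 ^+ p)).
by rewrite (idealD idealM) ?frob_graph_mod ?(idealX idealM) ?prime_gt0.
Qed.

(** The transfer applied to the transposed graph; it makes the lift injective. *)
Lemma frob_graph_inj z : G z -> z.2 = 0 -> z.1 = 0.
Proof.
have [a pa0 pSa0] := nilp; case: subringG => G1 GB GM.
pose P (w : R * R) := G (w.2, w.1); pose swap (w : R * R) := (w.2, w.1).
move=> Gz z2.
apply: (transfer_eq0 idealM unitM Mgen pa0 pSa0 q_gt1 (P := P) _ _ _
  (z := swap z)) => //.
- by split=> [|u v|u v]; [exact: G1|exact: GB|exact: GM].
- move=> w /fixG[h Gh E]; exists (swap h); first by rewrite /P -surjective_pairing.
  apply: injective_projections; [have := congr1 snd E|have := congr1 fst E];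
    by rewrite !(rmorphD, rmorphXn, rmorphM, rmorph_nat).
- move=> w Gw /= Mw1; apply: (max_primeX idealM unitM (n := p)).
  have /(idealN idealM) := frob_graph_mod Gw; rewrite opprB /=.
  by rewrite (idealDl idealM) // (idealN idealM).
by rewrite /P /= -surjective_pairing.
Qed.

(** Successive approximation: x is expanded in powers of p with digits satisfying t^q = t, and
    p^(a+1) = 0 ends the expansion. *)
Lemma frob_graph_total x : exists y, G (x, y).
Proof.
have [a _ pSa0] := nilp; case: (subringG) => _ _ GM.
suff H n : exists z w, G z /\ x - z.1 = p%:R ^+ n * w.
  have [z [w [Gz]]] := H a.+1; rewrite pSa0 mul0r => /eqP.
  by rewrite subr_eq0 => /eqP ->; exists z.2; rewrite -surjective_pairing.
elim: n => [|n [z [w [Gz zE]]]].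
  by exists 0, x; split; [exact: subring_pred0|rewrite subr0 mul1r].
have [t tE /Mgen[v wE]] := teichmuller w.
exists (z + p%:R ^+ n * (t, t ^+ p)), v; split.
  apply: subring_predD => //; apply: (GM); last exact: FrobGen.
  by apply: subring_predX => //; apply: subring_pred_nat.
rewrite rmorphD rmorphM rmorphXn rmorph_nat /= opprD addrA zE exprSr.
by rewrite -mulrA -wE mulrBr.
Qed.

Lemma frobenius_automorphism : exists s : {rmorphism R -> R},
  bijective s /\ forall t, t ^+ (p ^ d) = t -> s t = t ^+ p.
Proof.
have [s Gs] := fin_all_exists frob_graph_total.
have [G1 GB GM] := subringG.
have sP x y : G (x, y) -> s x = y.
  move=> Gxy; apply/eqP; rewrite -subr_eq0; apply/eqP.
  by apply: (frob_graph_fun (GB _ _ (Gs x) Gxy)); rewrite /= subrr.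
have sB : zmod_morphism s by move=> x y; apply: sP; exact: GB (Gs x) (Gs y).
have sM : monoid_morphism s by split=> [|x y]; apply: sP; [exact: G1|exact: GM (Gs x) (Gs y)].
pose sBi := GRing.isZmodMorphism.Build R R s sB.
pose sMi := GRing.isMonoidMorphism.Build R R s sM.
pose s' : {rmorphism R -> R} := HB.pack s sBi sMi.
exists s'; split=> [|t tE]; last by apply: sP; apply: FrobGen.
apply: injF_bij; apply: raddf_inj => x /= sx0.
exact: (frob_graph_inj (Gs x)).
Qed.

Lemma rigid_principal_nat :
    (forall s : {rmorphism R -> R}, bijective s -> forall x, s x = x) ->
  forall x : R, exists n, x = n%:R.
Proof.
move=> rigid; have [s [/rigid s_id sE]] := frobenius_automorphism.
(* Rigidity gives t = t^p, hence x^p = x modulo [M]; the product of the x - i is then in [M], and so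
   is one of its factors. *)
have root x : exists n, x - n%:R \in M.
  have [t /sE tE Mxt] := teichmuller x; rewrite s_id in tE.
  have [h hE] := prod_sub_nat_prime x p_pr.
  have Mxp : x ^+ p - x \in M.
    have -> : x ^+ p - x = (x ^+ p - t ^+ p) - (x - t) by rewrite -tE; ring.
    by rewrite (idealB idealM) // subrXX (idealMr idealM).
  have: \prod_(i < p) (x - i%:R) \in M.
    by rewrite hE (idealD idealM) // (idealMr idealM).
  elim/big_ind: _ => [M1|u v IHu IHv|i _ Mi]; last by exists i.
    by case: idealM => _ /negP.
  by case/(max_prime idealM unitM)/orP.
move=> x; have [a _ pSa0] := nilp.
(* Again a p-adic expansion, now with integer digits. *)
suff H k : exists n w, x = n%:R + p%:R ^+ k * w.
  by have [n [w ->]] := H a.+1; exists n; rewrite pSa0 mul0r addr0.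
elim: k => [|k [n [w ->]]]; first by exists 0, x; rewrite add0r mul1r.
have [m /Mgen[v wE]] := root w.
exists (n + p ^ k * m)%N, v.
rewrite natrD natrM natrX exprSr -mulrA -wE; ring.
Qed.

End Principal.

Unset Implicit Arguments.

Theorem theorem3p1 (R : finComNzRingType) (M : {set R})
    (local_RM : local_ring M)
    (disc_R : totally_disconnected (@aut_adj R)) :
  (exists p alpha : nat,
     [/\ prime p, (1 <= alpha)%N & ring_isomorphic R 'Z_(p ^ alpha)])
  \/ ring_isomorphic R {poly %/ ('X^2 : {poly 'Z_2})}.
Proof.
have [[idealM _] _] := local_RM.
have unitM x := @local_ring_unit R M x local_RM.
have rigid (s : {rmorphism R -> R}) : bijective s -> forall x, s x = x.
  move=> bij_s x; apply/eqP/negPn/negP => /eqP neq_sx.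
  by apply: (disc_R x (s x)); split; [exact/nesym|exists s].
have [p p_pr Mp] := max_pchar idealM unitM.
have [d [d_gt0 _ teich]] := teichmuller_exponent idealM unitM p_pr Mp.
(* As p is in [M], the inclusion of [M] in pR decides whether M = pR. *)
case: (boolP [forall m in M, [exists y, m == p%:R * y]]) => [/forall_inP pM|].
  left; have Mgen m : m \in M -> exists y, m = p%:R * y.
    by move/pM/existsP => [y /eqP ->]; exists y.
  have natP := rigid_principal_nat idealM unitM p_pr Mp Mgen d_gt0 teich rigid.
  have [n pn0] := max_nilpotent idealM unitM Mp.
  have [b [b_gt0 iso]] := ring_isomorphic_Zp p_pr pn0 natP.
  by exists p, b.
rewrite negb_forall_in => /exists_inP[m Mm /existsPn m_indiv]; right.
have [|x [x0 xx0 two0 xP]] := rigid_nonprincipal idealM unitM rigid p_pr Mp.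
  by exists m.
exact: ring_isomorphic_dual_numbers x0 xx0 two0 xP.
Qed.
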